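(* Let $0\le m<n$ be integers and let $A$ be an $n\times n$ real positive definite matrix with eigenvalues $\lambda_1(A),\dots,\lambda_n(A)$, indexed in nondecreasing order, and corresponding eigenvectors $v_1(A),\dots,v_n(A)$. The optimal solutions to $$\underset{X}{\text{minimize}}\ \operatorname{tr}(XA^{-1})+\operatorname{tr}(X^{-1}A)\quad\text{subject to}\quad X\in\mathcal{L}_{m,n},\ X\succ0$$ for which $v_k(X)=v_k(A)$ for all $k\in\{1,\dots,n\}$ are precisely those such that $$\lambda_i(X)=\lambda=\left(\frac{\lambda_l(A)+\lambda_{l+1}(A)+\dots+\lambda_{l+n-m-1}(A)}{\lambda_l(A)^{-1}+\lambda_{l+1}(A)^{-1}+\dots+\lambda_{l+n-m-1}(A)^{-1}}\right)^{1/2}\quad\text{if } i\in\{l,\dots,l+n-m-1\},$$ $\lambda_i(X)=\lambda_i(A)$ otherwise, and $l$ is an integer (in $\{1,\dots,m+1\}$) that minimizes $$\sum_{i=l}^{l+n-m-1}\left(\frac{\lambda_i(A)}{\lambda}+\frac{\lambda}{\lambda_i(A)}\right),$$ where $\lambda$ depends on $l$ as displayed.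
   Context: $\mathcal{L}_{m,n}$ denotes the set of real $n\times n$ matrices $M$ that can be written as $M=\beta I+\sum_{i=1}^m a_iu_iu_i^T$ with $\beta,a_i\in\mathbb{R}$ and $u_i\in\mathbb{R}^n$. Positive definite matrices are understood to be symmetric, and $X\succ0$ means that $X$ is positive definite. The eigenvectors $v_1(A),\dots,v_n(A)$ form a fixed orthonormal basis, with $v_k(A)$ belonging to $\lambda_k(A)$. The condition $v_k(X)=v_k(A)$ for all $k$ means that each $v_k(A)$ is an eigenvector of $X$, and $\lambda_k(X)$ then denotes the eigenvalue of $X$ belonging to that eigenvector (so the $\lambda_k(X)$ are indexed by the eigenvectors of $A$).
   Formalization: When A has repeated eigenvalues, ''precisely'' holds only after permuting indices k with equal λ_k(A), or if the λ_k(X) are nondecreasing among such indices; literally it fails for A=diag(1,1,2,2), m=1, X=diag(b,1,b,b), b=√(5/2). *)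

(* Defs.v *)
From mathcomp Require Import all_boot all_order all_fingroup all_algebra.
From mathcomp Require Import reals.

Set Implicit Arguments.
Unset Strict Implicit.
Unset Printing Implicit Defensive.

Import Order.TTheory GRing.Theory Num.Theory.
Local Open Scope ring_scope.

Definition low_rank_shift (R : realType) (m n : nat) (M : 'M[R]_n) : Prop :=
  exists (beta : R) (a : 'I_m -> R) (u : 'I_m -> 'cV[R]_n),
    M = beta%:M + \sum_(i < m) a i *: (u i *m (u i)^T).

Definition posdef (R : realType) (n : nat) (M : 'M[R]_n) : Prop :=
  M^T = M /\ forall x : 'cV[R]_n, x != 0 -> 0 < (x^T *m M *m x) 0 0.

Definition objective (R : realType) (n : nat) (A X : 'M[R]_n) : R :=
  \tr (X *m invmx A) + \tr (invmx X *m A).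

Definition feasible (R : realType) (m n : nat) (X : 'M[R]_n) : Prop :=
  low_rank_shift m X /\ posdef X.

Definition optimal (R : realType) (m n : nat) (A X : 'M[R]_n) : Prop :=
  feasible m X /\
  forall Y : 'M[R]_n, feasible m Y -> objective A X <= objective A Y.

(* An orthonormal family of n vectors in R^n is a basis. *)
Definition orthonormal_basis (R : realType) (n : nat) (v : 'I_n -> 'cV[R]_n) : Prop :=
  forall i j : 'I_n, ((v i)^T *m v j) 0 0 = (i == j)%:R.

Definition eigen_along (R : realType) (n : nat) (v : 'I_n -> 'cV[R]_n)
    (M : 'M[R]_n) (mu : 'I_n -> R) : Prop :=
  forall k : 'I_n, M *m v k = mu k *: v k.

(* Indices start at 0: the window {l, ..., l + n - m - 1} of n - m consecutive
   indices starts at some l in {0, ..., m}. *)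
Definition window (m n : nat) (l : 'I_m.+1) : pred 'I_n :=
  fun i => (l <= i < l + (n - m))%N.

Definition window_value (R : realType) (m n : nat) (lam : 'I_n -> R)
    (l : 'I_m.+1) : R :=
  Num.sqrt ((\sum_(i < n | window l i) lam i)
            / (\sum_(i < n | window l i) (lam i)^-1)).

Definition window_cost (R : realType) (m n : nat) (lam : 'I_n -> R)
    (l : 'I_m.+1) : R :=
  \sum_(i < n | window l i)
     (lam i / window_value lam l + window_value lam l / lam i).

Definition optimal_spectrum (R : realType) (m n : nat)
    (lam mu : 'I_n -> R) : Prop :=
  exists l : 'I_m.+1,
    (forall l' : 'I_m.+1, window_cost lam l <= window_cost lam l') /\
    (forall i : 'I_n,
       mu i = if window l i then window_value lam l else lam i).

(* Main.v *)
(* A feasible Y = beta I + (rank <= m) acts as beta on the range of an orthogonal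
   projector P of trace n - m. With q_j = v_j^T P v_j in [0, 1], positivity of
   (1 - P) (Y - lam_j) Y^-1 (Y - lam_j) (1 - P) gives
   objective A Y >= sum_j (2 + q_j (c_j - 2)), c_j = lam_j / beta + beta / lam_j.
   As sum_j q_j = n - m and c_j is quasiconvex in lam_j, the right-hand side is
   smallest when q is the indicator of a window, and beta is then optimal when it
   is the window value; no diagonalisation of Y is needed.
   Conversely, in the equality case for X = sum_i mu_i v_i v_i^T, any n - m indices
   with mu_i = beta have minimal total c, hence mu is nondecreasing once it is so on
   the ties of lam, and {i | mu_i = beta} is an interval, which contains a window. *)
Require Import Defs.
From mathcomp Require Import all_boot all_order all_fingroup all_algebra.
From mathcomp Require Import reals.
From mathcomp Require Import ring lra zify.
Import Order.TTheory GRing.Theory Num.Theory.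
Local Open Scope ring_scope.

Set Implicit Arguments.
Unset Strict Implicit.
Unset Printing Implicit Defensive.

(** * The scalar cost x / y + y / x *)

Definition ratio_cost (R : realFieldType) (y x : R) : R := x / y + y / x.

Lemma ratio_costE (R : realFieldType) (y x : R) : 0 < y -> 0 < x ->
  ratio_cost y x = 2 + (y - x) ^+ 2 / (x * y).
Proof.
by move=> y0 x0; rewrite /ratio_cost; field; rewrite !gt_eqF.
Qed.

Lemma ratio_cost_ge2 (R : realFieldType) (y x : R) : 0 < y -> 0 < x ->
  2 <= ratio_cost y x.
Proof.
move=> y0 x0; rewrite ratio_costE // lerDl divr_ge0 ?sqr_ge0 //.
by rewrite mulr_ge0 ?ltW.
Qed.

Lemma ratio_cost_eq2 (R : realFieldType) (y x : R) : 0 < y -> 0 < x ->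
  ratio_cost y x = 2 -> y = x.
Proof.
move=> y0 x0; rewrite ratio_costE // => /eqP; rewrite -subr_eq0 addrC addKr.
rewrite mulf_eq0 sqrf_eq0 invr_eq0 mulf_eq0 !(gt_eqF x0, gt_eqF y0) !orbF.
by rewrite subr_eq0 => /eqP.
Qed.

Lemma ratio_costxx (R : realFieldType) (x : R) : 0 < x -> ratio_cost x x = 2.
Proof. by move=> x0; rewrite /ratio_cost divff ?gt_eqF. Qed.

(** The difference of the two costs factors through x' - x and y ^ 2 - x x', the latter being
    positive when x < x' <= y. The equality case is kept for the later analysis of ties. *)
Lemma ratio_cost_decr (R : realFieldType) (y x x' : R) : 0 < x -> x <= x' ->
  x' <= y -> ratio_cost y x' <= ratio_cost y x ?= iff (x == x').
Proof.
move=> x0 xx' x'y; have x'0 := lt_le_trans x0 xx'; have y0 := lt_le_trans x'0 x'y.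
have E : ratio_cost y x - ratio_cost y x' =
    (x' - x) * (y ^+ 2 - x * x') / (y * x * x').
  by rewrite /ratio_cost; field; rewrite !gt_eqF.
have [->|nxx'] := eqVneq x x'; first by split; rewrite ?eqxx.
have {nxx'}xx' : x < x' by rewrite lt_neqAle nxx'.
suff : ratio_cost y x' < ratio_cost y x by move=> h; split; rewrite ?ltW // lt_eqF.
rewrite -subr_gt0 E divr_gt0 ?mulr_gt0 ?subr_gt0 //; nra.
Qed.

Lemma ratio_cost_incr (R : realFieldType) (y x x' : R) : 0 < y -> y <= x ->
  x <= x' -> ratio_cost y x <= ratio_cost y x' ?= iff (x == x').
Proof.
move=> y0 yx xx'; have x0 := lt_le_trans y0 yx; have x'0 := lt_le_trans x0 xx'.
have E : ratio_cost y x' - ratio_cost y x =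
    (x' - x) * (x * x' - y ^+ 2) / (y * x * x').
  by rewrite /ratio_cost; field; rewrite !gt_eqF.
have [->|nxx'] := eqVneq x x'; first by split; rewrite ?eqxx.
have {nxx'}xx' : x < x' by rewrite lt_neqAle nxx'.
suff : ratio_cost y x < ratio_cost y x' by move=> h; split; rewrite ?ltW // lt_eqF.
rewrite -subr_gt0 E divr_gt0 ?mulr_gt0 ?subr_gt0 //; nra.
Qed.

(** The cost decreases up to y and increases after it, so the endpoint on the same side of y as x
    dominates. *)
Lemma ratio_cost_quasiconvex (R : realFieldType) (y a x b : R) :
  0 < y -> 0 < a -> a <= x -> x <= b ->
  ratio_cost y x <= Num.max (ratio_cost y a) (ratio_cost y b).
Proof.
move=> y0 a0 ax xb; rewrite le_max; case: (leP x y) => xy.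
  by rewrite (ratio_cost_decr a0 ax xy).
by rewrite (ratio_cost_incr y0 (ltW xy) xb) orbT.
Qed.

(* [window_value] minimises [y |-> a y + b / y]. *)
Lemma sum_ratio_cost_min (R : rcfType) (I : finType) (P : pred I) (lam : I -> R)
    (y : R) (w := Num.sqrt ((\sum_(i | P i) lam i) / (\sum_(i | P i) (lam i)^-1))) :
  (exists i, P i) -> (forall i, 0 < lam i) -> 0 < y ->
  \sum_(i | P i) ratio_cost w (lam i) <= \sum_(i | P i) ratio_cost y (lam i)
    ?= iff (y == w).
Proof.
move=> [i0 Pi0] lam0 y0.
have sumE z : \sum_(i | P i) ratio_cost z (lam i) =
    (\sum_(i | P i) lam i) / z + z * (\sum_(i | P i) (lam i)^-1).
  by rewrite big_split /= mulr_sumr mulr_suml.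
have psum F : (forall i, 0 < F i) -> 0 < \sum_(i | P i) F i :> R.
  move=> F0; rewrite (bigD1 i0) //= ltr_wpDr // sumr_ge0 // => i _; exact: ltW.
have b0 : 0 < \sum_(i | P i) lam i by apply: psum.
have a0 : 0 < \sum_(i | P i) (lam i)^-1 by apply: psum => i; rewrite invr_gt0.
rewrite !{}sumE; move: (\sum_(i | P i) lam i) (\sum_(i | P i) (lam i)^-1) @w b0 a0.
move=> b a w b0 a0; have w0 : 0 < w by rewrite sqrtr_gt0 divr_gt0.
(* Eliminating b through w ^ 2 = b / a turns the gap between the two sums into a completed square,
   which also settles the equality case. *)
have {b0} -> : b = a * w ^+ 2.
  by rewrite sqr_sqrtr ?divr_ge0 ?ltW // mulrC divfK ?gt_eqF.
have E : a * w ^+ 2 / y + y * a - (a * w ^+ 2 / w + w * a) = a / y * (y - w) ^+ 2.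
  by field; rewrite !gt_eqF.
split; first by rewrite -subr_ge0 E mulr_ge0 ?sqr_ge0 // divr_ge0 ?ltW.
rewrite eq_sym -subr_eq0 E mulf_eq0 sqrf_eq0 subr_eq0 mulf_eq0 invr_eq0.
by rewrite (gt_eqF a0) (gt_eqF y0).
Qed.

(** * Orthogonal projectors inside a kernel *)

(** Gram-Schmidt, one dimension at a time: as long as k + m < n, some nonzero vector is killed by
    both [U] and the current projector, and the projector onto its line is added. The rank bound is
    what carries the induction. *)
Lemma exists_projector (F : realFieldType) (m n k : nat) (U : 'M[F]_(m, n)) :
  (k + m <= n)%N ->
  exists P : 'M[F]_n, [/\ P^T = P, P *m P = P, U *m P = 0,
    \tr P = k%:R & (\rank P <= k)%N].
Proof.
elim: k => [|k IH] hk.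
  by exists 0; rewrite trmx0 !mulmx0 mxtrace0 mxrank0.
have [P [Psym PP UP trP rP]] := IH (ltnW hk).
have : kermx (col_mx U P)^T != 0.
  rewrite kermx_eq0 -row_leq_rank -ltnNge mxrank_tr -addsmxE.
  rewrite (leq_ltn_trans (mxrank_adds_leqif _ _).1) // (leq_trans _ hk) //.
  by rewrite addSn ltnS addnC leq_add // rank_leq_row.
case/rowV0Pn=> y /sub_kermxP; rewrite tr_col_mx mul_mx_row => /eqP.
rewrite -row_mx0 => /eqP/eq_row_mx [yU yP] y0.
have Py : P *m y^T = 0 by rewrite -[P]trmxK -trmx_mul yP trmx0.
have Uy : U *m y^T = 0 by rewrite -[U]trmxK -trmx_mul yU trmx0.
rewrite Psym in yP.
pose c := (y *m y^T) 0 0.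
have yy : y *m y^T = c%:M by rewrite [LHS]mx11_scalar.
(* c is the squared norm of y, and a sum of squares vanishes only if every square does. *)
have c0 : c != 0.
  apply: contraNneq y0 => c0; apply/eqP/rowP => i; rewrite mxE.
  have : \sum_j y 0 j ^+ 2 = 0.
    by rewrite -[RHS]c0 /c mxE; apply: eq_bigr => j _; rewrite mxE expr2.
  have sq_ge0 j : true -> 0 <= y 0 j ^+ 2 by rewrite sqr_ge0.
  by move=> /(psumr_eq0P sq_ge0)/(_ i isT)/eqP; rewrite sqrf_eq0 => /eqP.
exists (P + c^-1 *: (y^T *m y)); split.
- by rewrite linearD linearZ /= trmx_mul trmxK Psym.
- rewrite mulmxDl !mulmxDr PP -!scalemxAl -!scalemxAr -!mulmxA yP !mulmx0.
  rewrite [P *m (y^T *m y)]mulmxA Py mul0mx !scaler0 addr0 add0r.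
  rewrite [y *m (_ *m _)]mulmxA yy mul_scalar_mx -scalemxAr !scalerA.
  by rewrite mulVf // mulr1.
- by rewrite mulmxDr UP -scalemxAr mulmxA Uy mul0mx scaler0 addr0.
- rewrite mxtraceD mxtraceZ mxtrace_mulC yy mxtrace_scalar trP mulVf //.
  by rewrite -natr1.
- rewrite (leq_trans (mxrank_add _ _)) // -[k.+1]addn1 leq_add //.
  rewrite (leq_trans (mxrank_scale _ _)) // (leq_trans (mxrankM_maxr _ _)) //.
  exact: rank_leq_row.
Qed.

(** * Minimisation over windows *)

(* Discard the endpoint with the larger value, [d] times. *)
Lemma exists_minimal_interval (R : realDomainType) (n d : nat) (g : 'I_n -> R) :
  (forall i j k : 'I_n, (i <= j <= k)%N -> g j <= Num.max (g i) (g k)) ->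
  (d < n)%N ->
  exists2 a : nat, (a <= d)%N & forall i j : 'I_n,
    (a <= i < a + (n - d))%N -> ~~ (a <= j < a + (n - d))%N -> g i <= g j.
Proof.
move=> qc; elim: d => [|d IH] dn.
  by exists 0%N => // i j _; rewrite leq0n add0n subn0 ltn_ord.
have [a ad ha] := IH (ltnW dn).
have an : (a < n)%N by lia.
have bn : ((a + (n - d)).-1 < n)%N by lia.
pose i0 := Ordinal an; pose i1 := Ordinal bn.
(* By quasiconvexity the larger endpoint value bounds g on the whole interval, hence the discarded
   index dominates all remaining ones. *)
have [g01|g10] := leP (g i0) (g i1).
  exists a; first by rewrite ltnW.
  move=> i j hi hj; have [hj'|hj'] := boolP (a <= j < a + (n - d))%N.
    have -> : j = i1 by apply: val_inj => /=; lia.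
    have /(qc i0 i i1) : (i0 <= i <= i1)%N by rewrite /=; lia.
    by rewrite (max_idPr g01).
  by apply: ha hj'; lia.
exists a.+1; first by [].
move=> i j hi hj; have [hj'|hj'] := boolP (a <= j < a + (n - d))%N.
  have -> : j = i0 by apply: val_inj => /=; lia.
  have /(qc i0 i i1) : (i0 <= i <= i1)%N by rewrite /=; lia.
  by rewrite (max_idPl (ltW g10)).
by apply: ha hj'; lia.
Qed.

Lemma card_window (m n : nat) (l : 'I_m.+1) :
  (m <= n)%N -> #|@window m n l| = (n - m)%N.
Proof.
move=> mn; have lm := ltn_ord l.
have ln : (l + (n - m) <= n)%N by lia.
rewrite -sum1_card -(big_mkord (fun i => (l <= i < l + (n - m))%N) (fun=> 1%N)).
rewrite -[(n - m)%N in RHS](addKn l) -[RHS]muln1 -sum_nat_const_nat.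
rewrite (big_nat_widen _ _ _ _ _ ln) (big_nat_widenl _ _ _ _ _ (leq0n l)).
by apply: eq_bigl => i; rewrite andbC.
Qed.

(** Bathtub principle: a threshold t separates the values of g on the best window from those off it.
    Since both weightings have total mass n - m, g may be replaced by g - t, and the comparison then
    holds term by term. *)
Lemma window_sum_min (R : realDomainType) (m n : nat) (g q : 'I_n -> R) :
  (m < n)%N ->
  (forall i j k : 'I_n, (i <= j <= k)%N -> g j <= Num.max (g i) (g k)) ->
  (forall i, 0 <= q i <= 1) -> \sum_i q i = (n - m)%:R ->
  exists l : 'I_m.+1, \sum_(i < n | window l i) g i <= \sum_i q i * g i.
Proof.
move=> mn qc q01 sq; have [a am ha] := exists_minimal_interval qc mn.
pose l : 'I_m.+1 := Ordinal (am : (a < m.+1)%N); exists l.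
have i0n : (a < n)%N by lia.
have wi0 : window l (Ordinal i0n) by rewrite /window /=; lia.
(* t is the maximum of g on the window. *)
have [t tW tC] : exists2 t, forall i, window l i -> g i <= t &
    forall i, ~~ window l i -> t <= g i.
  case: (arg_maxP g wi0) => i wi gi; exists (g i) => j wj; first exact: gi.
  exact: ha.
have -> : \sum_(i < n | window l i) g i =
    \sum_(i < n | window l i) (g i - t) + t * \sum_i q i.
  rewrite big_split /= sumr_const card_window 1?ltnW // sq mulNrn.
  by rewrite mulr_natr subrK.
rewrite mulr_sumr -lerBrDr -sumrB big_mkcond /=; apply: ler_sum => i _.
have /andP[q0 q1] := q01 i; case: ifPn => [/tW|/tC]; nra.
Qed.

(** The weights are first moved to a window with y fixed, then y is replaced by the optimal value
    for that window. The constant is 2 n - 2 (n - m) = 2 m. *)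
Lemma window_cost_le (R : realType) (m n : nat) (lam q : 'I_n -> R) (y : R) :
  (m < n)%N -> (forall i, 0 < lam i) ->
  (forall i j : 'I_n, (i <= j)%N -> lam i <= lam j) ->
  0 < y -> (forall i, 0 <= q i <= 1) -> \sum_i q i = (n - m)%:R ->
  exists l : 'I_m.+1, m%:R * 2 + window_cost lam l <=
    \sum_i (2 + q i * (ratio_cost y (lam i) - 2)).
Proof.
move=> mn lam0 lam_sorted y0 q01 sq.
have qc (i j k : 'I_n) : (i <= j <= k)%N -> ratio_cost y (lam j) <=
    Num.max (ratio_cost y (lam i)) (ratio_cost y (lam k)).
  by move=> /andP[ij jk]; apply: ratio_cost_quasiconvex => //; apply: lam_sorted.
have [l hl] := window_sum_min mn qc q01 sq; exists l.
have -> : \sum_i (2 + q i * (ratio_cost y (lam i) - 2)) =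
    m%:R * 2 + \sum_i q i * ratio_cost y (lam i).
  under eq_bigr do rewrite mulrBr addrC -addrA [- _ + _]addrC.
  rewrite big_split sumrB -mulr_suml sq sumr_const card_ord /= natrB 1?ltnW //.
  rewrite -mulr_natl; ring.
rewrite lerD2l (le_trans _ hl) // sum_ratio_cost_min //.
have ln : (l < n)%N by rewrite (leq_trans (ltn_ord l)).
exists (Ordinal ln); rewrite /window /=; lia.
Qed.

(** * Optimality in terms of eigenvalues *)

(** The first two clauses encode feasibility of [spectral_mx v mu], the last one optimality against
    all windows. Unlike [optimal_spectrum], this condition is invariant under relabelling ties of
    [lam], which makes it the intermediate notion between matrices and windows. *)
Definition optimal_eigenvalues (R : realType) (m n : nat) (lam mu : 'I_n -> R) : Prop :=
  [/\ forall i, 0 < mu i,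
      exists y : R, (n - m <= #|[pred i | mu i == y]|)%N &
      forall l : 'I_m.+1,
        \sum_i ratio_cost (mu i) (lam i) <= m%:R * 2 + window_cost lam l].

Lemma window_value_gt0 (R : realType) (m n : nat) (lam : 'I_n -> R) (l : 'I_m.+1) :
  (m < n)%N -> (forall i, 0 < lam i) -> 0 < window_value lam l.
Proof.
move=> mn lam0; have ln : (l < n)%N by rewrite (leq_trans (ltn_ord l)).
have wl : window l (Ordinal ln) by rewrite /window /=; lia.
rewrite sqrtr_gt0 divr_gt0 // (bigD1 _ wl) /= ltr_wpDr ?sumr_ge0 ?invr_gt0 //.
  by move=> i _; rewrite ltW.
by move=> i _; rewrite invr_ge0 ltW.
Qed.

Lemma sum_ratio_cost_window (R : realType) (m n : nat) (lam mu : 'I_n -> R)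
    (l : 'I_m.+1) (y : R) : (m < n)%N -> (forall i, 0 < lam i) ->
  (forall i, mu i = if window l i then y else lam i) ->
  \sum_i ratio_cost (mu i) (lam i) =
    m%:R * 2 + \sum_(i < n | window l i) ratio_cost y (lam i).
Proof.
move=> mn lam0 muE; rewrite (bigID (window l)) /= addrC; congr (_ + _); last first.
  by apply: eq_bigr => i wi; rewrite muE wi.
rewrite (eq_bigr (fun=> 2)) => [|i /negPf wi]; last by rewrite muE wi ratio_costxx.
rewrite sumr_const mulr_natl; congr (_ *+ _).
apply: (@addnI (n - m)%N); rewrite subnK 1?ltnW //.
by rewrite -[in LHS](card_window l (ltnW mn)) cardC card_ord.
Qed.

Lemma optimal_spectrum_eigenvalues (R : realType) (m n : nat) (lam mu : 'I_n -> R) :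
  (m < n)%N -> (forall i, 0 < lam i) ->
  optimal_spectrum m lam mu -> optimal_eigenvalues m lam mu.
Proof.
move=> mn lam0 [l [lmin muE]]; split.
- by move=> i; rewrite muE; case: ifP; rewrite ?window_value_gt0.
- exists (window_value lam l); rewrite -(card_window l (ltnW mn)).
  by apply/subset_leq_card/subsetP => i wi; rewrite inE muE [window _ _]wi.
- move=> l'; rewrite (sum_ratio_cost_window mn lam0 muE) lerD2l.
  exact: lmin.
Qed.

Lemma optimal_eigenvalues_perm (R : realType) (m n : nat) (lam mu : 'I_n -> R)
    (s : 'S_n) : (forall k, lam (s k) = lam k) ->
  optimal_eigenvalues m lam (fun k => mu (s k)) <-> optimal_eigenvalues m lam mu.
Proof.
move=> ls; have sumE : \sum_i ratio_cost (mu (s i)) (lam i) =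
    \sum_i ratio_cost (mu i) (lam i).
  by rewrite [RHS](reindex_inj (@perm_inj _ s)); apply: eq_bigr => i _; rewrite ls.
have cardE y : #|[pred i | mu (s i) == y]| = #|[pred i | mu i == y]|.
  by rewrite -!sum1_card [RHS](reindex_inj (@perm_inj _ s)).
split=> -[mu0 [y hy] hl]; split=> //; try by exists y; rewrite -?cardE // cardE.
- by move=> i; rewrite -(permKV s i).
- by move=> l; rewrite -sumE.
- by move=> l; rewrite sumE.
Qed.

(* Exchanging an inversion inside a tie increases [\sum_k k * mu (s k)]. *)
Lemma exists_perm_sorted_on_ties (R : realDomainType) (n : nat) (lam mu : 'I_n -> R) :
  exists2 s : 'S_n, forall k, lam (s k) = lam k &
    forall i j : 'I_n, (i <= j)%N -> lam i = lam j -> mu (s i) <= mu (s j).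
Proof.
pose P (s : 'S_n) := [forall k, lam (s k) == lam k].
have P1 : P 1%g by apply/forallP => k; rewrite perm1.
case: (arg_maxP (fun s : 'S_n => \sum_(k < n) k%:R * mu (s k)) P1) => s /forallP ls smax.
exists s => [k|i j]; first exact/eqP.
rewrite leq_eqVlt => /orP[/eqP/val_inj -> //|ij lij].
have nij : i != j by rewrite neq_ltn ij.
rewrite leNgt; apply/negP => inv.
have /smax : P (tperm i j * s)%g.
  apply/forallP => k; rewrite permM.
  by case: tpermP => [->|->|_ _]; rewrite (eqP (ls _)) ?lij.
rewrite /= (bigD1 i) //= [in X in _ <= X](bigD1 i) //=.
rewrite (bigD1 j) 1?eq_sym //= [in X in _ <= X](bigD1 j) 1?eq_sym //=.
rewrite !permM tpermL tpermR.
have -> : \sum_(k < n | (k != i) && (k != j)) k%:R * mu ((tperm i j * s)%g k) =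
    \sum_(k < n | (k != i) && (k != j)) k%:R * mu (s k).
  by apply: eq_bigr => k /andP[ki kj]; rewrite permM tpermD // eq_sym.
rewrite !addrA lerD2r; apply/negP; rewrite -ltNge -subr_gt0.
rewrite (_ : _ - _ = (j%:R - i%:R) * (mu (s i) - mu (s j))); last by ring.
by rewrite mulr_gt0 // subr_gt0 ?ltr_nat.
Qed.

(** The lower bound is tested with indicator weights of sets of n - m indices. Sets on which [mu]
    equals y attain equality, and this forces [mu] to be monotone, then to follow a window. *)
Lemma optimal_eigenvalues_spectrum (R : realType) (m n : nat) (lam mu : 'I_n -> R) :
  (m < n)%N -> (forall i, 0 < lam i) ->
  (forall i j : 'I_n, (i <= j)%N -> lam i <= lam j) ->
  (forall i j : 'I_n, (i <= j)%N -> lam i = lam j -> mu i <= mu j) ->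
  optimal_eigenvalues m lam mu -> optimal_spectrum m lam mu.
Proof.
move=> mn lam0 lam_sorted tie [mu0 [y hy] hl].
set T := [pred i | mu i == y] in hy *.
have [i0 Ti0] : exists i0, i0 \in T.
  by apply/card_gt0P; rewrite (leq_trans _ hy) ?subn_gt0.
have y0 : 0 < y by rewrite -(eqP Ti0).
(* The lower bound of [window_cost_le] for the weights q = indicator of S. *)
pose F (S : {set 'I_n}) := \sum_i (2 + (i \in S)%:R * (ratio_cost y (lam i) - 2)).
have obj_le (S : {set 'I_n}) : #|S| = (n - m)%N ->
    \sum_i ratio_cost (mu i) (lam i) <= F S.
  move=> cS; pose q i : R := (i \in S)%:R.
  have [||l] := window_cost_le (q := q) mn lam0 lam_sorted y0; rewrite /q.
  - by move=> i; case: (i \in S); rewrite ?ler01 ?lexx.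
  - by rewrite -cS -sumr_const [RHS]big_mkcond; apply: eq_bigr => i _; case: (i \in S).
  - exact: le_trans.
(* For S inside T, F S is also at most the objective term by term, so every term is an equality. Off
   S this means cost 2, that is, mu i = lam i. *)
have off (S : {set 'I_n}) : #|S| = (n - m)%N -> {subset S <= T} ->
    F S = \sum_i ratio_cost (mu i) (lam i) /\
    forall i, i \notin S -> mu i = lam i.
  move=> cS ST; have term i : 2 + (i \in S)%:R * (ratio_cost y (lam i) - 2) <=
      ratio_cost (mu i) (lam i) ?= iff ((i \in S) || (mu i == lam i)).
    have [iS|_] /= := boolP (i \in S).
      by rewrite mul1r addrC subrK (eqP (ST _ iS)); split; rewrite ?eqxx.
    rewrite mul0r addr0; split; first exact: (ratio_cost_ge2 (mu0 i) (lam0 i)).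
    by apply/eqP/eqP => [/esym|->]; [exact: ratio_cost_eq2 | rewrite ratio_costxx].
  have FS : F S = \sum_i ratio_cost (mu i) (lam i).
    apply/le_anti; rewrite obj_le // andbT; apply: ler_sum => i _.
    by have [] := term i.
  split=> // i iS; have := leif_sum (P := predT) (fun i _ => term i).
  rewrite -/(F S) FS => -[_].
  by rewrite eqxx => /esym/forallP/(_ i); rewrite (negPf iS) => /eqP.
(* S minimises F among sets of its size, so swapping i for j cannot lower the total. *)
have exchange (S : {set 'I_n}) i j : #|S| = (n - m)%N -> {subset S <= T} ->
    i \in S -> j \notin S -> ratio_cost y (lam i) <= ratio_cost y (lam j).
  move=> cS ST iS jS; have [FS _] := off S cS ST.
  have jS' : j \notin S :\ i by rewrite inE (negPf jS) andbF.
  have := @obj_le (j |: (S :\ i)); rewrite cardsU1 jS' -FS.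
  have FE S' : F S' = \sum_(i < n) 2 + \sum_(i in S') (ratio_cost y (lam i) - 2).
    rewrite /F big_split [X in _ = _ + X]big_mkcond; congr (_ + _).
    by apply: eq_bigr => k _; case: (k \in S'); rewrite ?mul1r ?mul0r.
  have := cardsD1 i S; rewrite iS cS => cSi; rewrite -cSi => /(_ erefl).
  by rewrite !FE lerD2l big_setU1 //= (big_setD1 i) //= lerD2r lerD2r.
have [S cS ST] : exists2 S : {set 'I_n}, #|S| = (n - m)%N & {subset S <= T}.
  have /card_geqP[s [us ss sT]] := hy; exists [set i in s].
    by rewrite cardsE -ss; apply/card_uniqP.
  by move=> i; rewrite inE => /sT.
(* With exactly one of i, j in S, a descent of [mu] puts both [lam] values on one side of y;
   monotonicity of the cost and [exchange] then force lam i = lam j, where [tie] excludes the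
   descent. *)
have mu_mono (i j : 'I_n) : (i <= j)%N -> mu i <= mu j.
  move=> ij; have lij := lam_sorted _ _ ij; have [_ offS] := off S cS ST.
  have [iS|iS] := boolP (i \in S); have [jS|jS] := boolP (j \in S).
  - by rewrite (eqP (ST _ iS)) (eqP (ST _ jS)).
  - rewrite (eqP (ST _ iS)) (offS _ jS) leNgt; apply/negP => ljy.
    have := ratio_cost_decr (lam0 i) lij (ltW ljy).
    move=> [le]; rewrite eq_le le (exchange S) //= => /esym/eqP/(tie _ _ ij).
    by rewrite (eqP (ST _ iS)) (offS _ jS) leNgt ljy.
  - rewrite (eqP (ST _ jS)) (offS _ iS) leNgt; apply/negP => yli.
    have := ratio_cost_incr y0 (ltW yli) lij.
    move=> [le]; rewrite eq_le le (exchange S) //= => /esym/eqP/(tie _ _ ij).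
    by rewrite (eqP (ST _ jS)) (offS _ iS) leNgt yli.
  - by rewrite !offS.
(* The window starts at the first index of T; a <= m because T has at least n - m elements. *)
case: (arg_minnP val Ti0) => a Ta amin.
have Tge (i : 'I_n) : i \in T -> (a <= i)%N by exact: amin.
have cardT (b : nat) : (forall i : 'I_n, i \in T -> (i < b)%N) -> (#|T| <= b - a)%N.
  move=> Tb; rewrite cardE -(size_map val) -(size_iota a (b - a)).
  apply: uniq_leq_size; first by rewrite map_inj_uniq ?enum_uniq //; exact: val_inj.
  move=> k /mapP[i]; rewrite mem_enum mem_iota => iT ->.
  have := Tge i iT; have := Tb i iT; rewrite /=; lia.
have am : (a < m.+1)%N.
  have := cardT n (fun i _ => ltn_ord i); have := ltn_ord a; lia.
pose l : 'I_m.+1 := Ordinal am.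
have wT (i : 'I_n) : window l i -> mu i = y.
  rewrite /window /= => /andP[ai ian]; apply/eqP; apply/negPn/negP => niT.
  have yi : y < mu i by rewrite lt_neqAle eq_sym niT -(eqP Ta) mu_mono.
  (* Since mu i exceeds y, monotonicity confines T to the indices from a up to i - 1, which are
     fewer than n - m. *)
  suff /cardT : forall j : 'I_n, j \in T -> (j < i)%N by lia.
  move=> j Tj; rewrite ltnNge; apply/negP => /mu_mono.
  by rewrite (eqP Tj) leNgt yi.
pose W := [set i | @window m n l i].
have cW : #|W| = (n - m)%N by rewrite cardsE card_window // ltnW.
have WT : {subset W <= T} by move=> i; rewrite inE => /wT/eqP.
have muE i : mu i = if window l i then y else lam i.
  by case: ifPn => [/wT //|wi]; apply: (off W cW WT).2; rewrite inE.
have := hl l; rewrite (sum_ratio_cost_window mn lam0 muE) lerD2l => le_l.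
(* y does at least as well on this window as its unique minimiser. *)
have yE : y = window_value lam l.
  have wl : exists i, @window m n l i by exists a; rewrite /window /=; lia.
  have [le eqE] := sum_ratio_cost_min wl lam0 y0.
  apply/eqP; rewrite -eqE eq_le le; exact: le_l.
exists l; split=> [l'|i]; last by rewrite muE yE.
have := hl l'; rewrite (sum_ratio_cost_window mn lam0 muE) lerD2l yE; exact.
Qed.

(** * Quadratic forms and positive definiteness *)

Definition quad (R : comPzRingType) (n : nat) (M : 'M[R]_n) (x : 'cV[R]_n) : R :=
  (x^T *m M *m x) 0 0.

Lemma quadD (R : comPzRingType) (n : nat) (M N : 'M[R]_n) x :
  quad (M + N) x = quad M x + quad N x.
Proof. by rewrite /quad mulmxDr mulmxDl mxE. Qed.

Lemma quadZ (R : comPzRingType) (n : nat) c (M : 'M[R]_n) x :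
  quad (c *: M) x = c * quad M x.
Proof. by rewrite /quad -scalemxAr -scalemxAl mxE. Qed.

Lemma quadN (R : comPzRingType) (n : nat) (M : 'M[R]_n) x :
  quad (- M) x = - quad M x.
Proof. by rewrite -scaleN1r quadZ mulN1r. Qed.

Lemma quad_mul (R : comPzRingType) (n : nat) (M N : 'M[R]_n) x :
  quad M (N *m x) = quad (N^T *m M *m N) x.
Proof. by rewrite /quad trmx_mul !mulmxA. Qed.

Lemma quad1_ge0 (R : realDomainType) (n : nat) (x : 'cV[R]_n) : 0 <= quad 1%:M x.
Proof. by rewrite /quad mulmx1 mxE sumr_ge0 // => i _; rewrite mxE -expr2 sqr_ge0. Qed.

Lemma posdef_quad_ge0 (R : realType) (n : nat) (M : 'M[R]_n) x :
  posdef M -> 0 <= quad M x.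
Proof.
move=> [_ M0]; have [->|x0] := eqVneq x 0; last exact/ltW/M0.
by rewrite /quad mulmx0 mxE.
Qed.

Lemma posdef_unitmx (R : realType) (n : nat) (M : 'M[R]_n) :
  posdef M -> M \in unitmx.
Proof.
move=> [_ M0]; rewrite -row_free_unit -kermx_eq0; apply/rowV0P => y /sub_kermxP yM.
apply/eqP; apply: contraT => y0; have := M0 y^T.
by rewrite trmxK yM mul0mx mxE ltxx -trmx0 (inj_eq trmx_inj) => /(_ y0).
Qed.

Lemma invmx_sym (R : comUnitRingType) (n : nat) (M : 'M[R]_n) :
  M^T = M -> (invmx M)^T = invmx M.
Proof. by move=> Msym; rewrite trmx_inv Msym. Qed.

Lemma posdef_invmx (R : realType) (n : nat) (M : 'M[R]_n) :
  posdef M -> posdef (invmx M).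
Proof.
move=> pM; have uM := posdef_unitmx pM; have [Msym M0] := pM.
split=> [|x x0]; first exact: invmx_sym.
have {1}-> : invmx M = (invmx M)^T *m M *m invmx M.
  by rewrite invmx_sym // -mulmxA mulmxV // mulmx1.
rewrite -/(quad _ _) -quad_mul; apply: M0.
by apply: contra_neq x0 => x0; rewrite -(mulKVmx uM x) x0 mulmx0.
Qed.

(** * Estimates with an orthogonal projector *)

Section ProjectorEstimates.

Variables (R : realType) (n : nat) (P : 'M[R]_n).
Hypotheses (Psym : P^T = P) (PP : P *m P = P).

Lemma quad_projector (x : 'cV[R]_n) : quad P x = quad 1%:M (P *m x).
Proof. by rewrite quad_mul Psym mulmx1 PP. Qed.

(** Both [P] and [1 - P] are orthogonal projectors, so their quadratic forms are squared norms. *)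
Lemma quad_projector_bounds (x : 'cV[R]_n) : 0 <= quad P x <= quad 1%:M x.
Proof.
rewrite quad_projector quad1_ge0 -quad_projector -subr_ge0 -quadN -quadD.
have -> : quad (1%:M - P) x = quad 1%:M ((1%:M - P) *m x).
  rewrite quad_mul [_^T]linearB /= trmx1 Psym mulmx1 mulmxBr mulmx1 mulmxBl mul1mx.
  by rewrite PP subrr subr0.
exact: quad1_ge0.
Qed.

(* This is [0 <= w^T Y^-1 w] for [w = (Y - t) (1 - P) x]. *)
Lemma quad_sum_inv_ge (Y : 'M[R]_n) (b t : R) (x : 'cV[R]_n) :
  posdef Y -> Y *m P = b *: P -> 0 < b -> 0 < t -> quad 1%:M x = 1 ->
  2 + quad P x * (ratio_cost b t - 2) <= quad Y x / t + quad (invmx Y) x * t.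
Proof.
move=> pY YP b0 t0 x1; have uY := posdef_unitmx pY; have [Ysym _] := pY.
have IP : invmx Y *m P = b^-1 *: P.
  by rewrite -[P in LHS](scale1r) -(mulVf (lt0r_neq0 b0)) -scalerA -YP
    -scalemxAr mulmxA mulVmx // mul1mx.
have PI : P *m invmx Y = b^-1 *: P.
  by apply: trmx_inj; rewrite trmx_mul linearZ /= Psym invmx_sym.
(* This is (Y - t) (1 - P), expanded with Y P = b P. *)
pose N := Y - t%:M - (b - t) *: P.
have Nsym : N^T = N by rewrite !linearB linearZ /= tr_scalar_mx Psym Ysym.
have NP : N *m P = 0.
  by rewrite /N !mulmxBl -scalemxAl PP YP mul_scalar_mx -!scalerBl subrr scale0r.
have IN : invmx Y *m N = 1%:M - t *: invmx Y - ((b - t) / b) *: P.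
  by rewrite /N !mulmxBr mulVmx // mul_mx_scalar -scalemxAr IP scalerA.
have NI : N *m invmx Y = 1%:M - t *: invmx Y - ((b - t) / b) *: P.
  by rewrite /N !mulmxBl mulmxV // mul_scalar_mx -scalemxAl PI scalerA.
have := posdef_quad_ge0 (N *m x) (posdef_invmx pY).
rewrite quad_mul Nsym -mulmxA IN !mulmxBr mulmx1 -!scalemxAr NP NI scaler0 subr0.
rewrite /N -[t%:M]scalemx1 !(quadD, quadN, quadZ) x1.
move: (quad Y x) (quad P x) (quad (invmx Y) x) => Yx Px Ix h.
rewrite -subr_ge0 /ratio_cost.
have -> : Yx / t + Ix * t - (2 + Px * (t / b + b / t - 2)) =
  (Yx - t * 1 - (b - t) * Px - t * (1 - t * Ix - (b - t) / b * Px)) / t.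
  by field; rewrite !gt_eqF.
by rewrite divr_ge0 // ltW.
Qed.

End ProjectorEstimates.

(** * Matrices diagonal in an orthonormal basis *)

Definition spectral_mx (R : pzRingType) (n : nat) (v : 'I_n -> 'cV[R]_n)
    (mu : 'I_n -> R) : 'M[R]_n :=
  \sum_i mu i *: (v i *m (v i)^T).

Lemma trace_mul_spectral_mx (R : comPzRingType) (n : nat) (v : 'I_n -> 'cV[R]_n)
    (mu : 'I_n -> R) (M : 'M[R]_n) :
  \tr (M *m spectral_mx v mu) = \sum_i quad M (v i) * mu i.
Proof.
rewrite mulmx_sumr raddf_sum; apply: eq_bigr => i _ /=.
rewrite -scalemxAr mxtraceZ mulmxA mxtrace_mulC mulmxA mulrC; congr (_ * _).
by rewrite [X in \tr X]mx11_scalar mxtrace_scalar.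
Qed.

Lemma spectral_mx_sym (R : comPzRingType) (n : nat) (v : 'I_n -> 'cV[R]_n)
    (mu : 'I_n -> R) : (spectral_mx v mu)^T = spectral_mx v mu.
Proof.
by rewrite raddf_sum; apply: eq_bigr => i _; rewrite /= linearZ /= trmx_mul trmxK.
Qed.

Section OrthonormalBasis.

Variables (R : realType) (n : nat) (v : 'I_n -> 'cV[R]_n).
Hypothesis hv : orthonormal_basis v.

Let quad_basis i : quad 1%:M (v i) = 1.
Proof. by rewrite /quad mulmx1 hv eqxx. Qed.

(** Resolution of the identity: for a square matrix V with columns v_j, V^T V = 1 implies V V^T =
    1. *)
Lemma spectral_mx1 : spectral_mx v (fun=> 1) = 1%:M.
Proof.
pose V : 'M[R]_n := \matrix_(i, j) v j i 0.
have VV : V^T *m V = 1%:M.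
  apply/matrixP => i j; rewrite !mxE -hv mxE.
  by apply: eq_bigr => k _; rewrite !mxE.
rewrite -(mulmx1C VV); apply/matrixP => i j; rewrite summxE mxE.
by apply: eq_bigr => k _; rewrite !mxE big_ord1 !mxE mul1r.
Qed.

Lemma eigen_along_eq (M : 'M[R]_n) (mu : 'I_n -> R) :
  eigen_along v M mu -> M = spectral_mx v mu.
Proof.
move=> hM; rewrite -[M]mulmx1 -spectral_mx1 mulmx_sumr; apply: eq_bigr => i _.
by rewrite scale1r mulmxA hM -scalemxAl.
Qed.

Lemma spectral_mx_eigen (mu : 'I_n -> R) : eigen_along v (spectral_mx v mu) mu.
Proof.
move=> k; rewrite mulmx_suml (bigD1 k) //= big1 ?addr0 => [|i ik].
  by rewrite -scalemxAl -mulmxA [X in _ *m X]mx11_scalar hv eqxx mulmx1.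
rewrite -scalemxAl -mulmxA [X in _ *m X]mx11_scalar hv (negPf ik).
by rewrite mul_mx_scalar scale0r scaler0.
Qed.

Lemma quad_eigen (M : 'M[R]_n) mu i : eigen_along v M mu -> quad M (v i) = mu i.
Proof. by move=> hM; rewrite /quad -mulmxA hM -scalemxAr mxE hv eqxx mulr1. Qed.

Lemma basis_neq0 i : v i != 0.
Proof.
by apply/eqP => v0; have := hv i i; rewrite v0 mulmx0 mxE eqxx => /eqP;
  rewrite eq_sym oner_eq0.
Qed.

Lemma posdef_spectral_mx (mu : 'I_n -> R) :
  posdef (spectral_mx v mu) <-> forall i, 0 < mu i.
Proof.
split=> [[_ M0] i|mu0].
  by rewrite -(quad_eigen i (spectral_mx_eigen mu)) M0 ?basis_neq0.
split=> [|x x0]; first exact: spectral_mx_sym.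
(* The form is a weighted sum of squared coordinates; if it vanishes, all coordinates of x do, and
   so does x. *)
have quadE nu : quad (spectral_mx v nu) x = \sum_i nu i * ((v i)^T *m x) 0 0 ^+ 2.
  rewrite /quad mulmx_sumr mulmx_suml summxE; apply: eq_bigr => i _.
  rewrite -scalemxAr -scalemxAl mxE; congr (_ * _).
  rewrite mulmxA -(mulmxA (x^T *m v i)) [X in X *m _]mx11_scalar.
  rewrite mul_scalar_mx mxE expr2; congr (_ * _).
  by rewrite -[x^T *m v i]trmxK trmx_mul trmxK mxE.
have term_ge0 i : 0 <= mu i * ((v i)^T *m x) 0 0 ^+ 2.
  by rewrite mulr_ge0 ?sqr_ge0 // ltW.
rewrite -/(quad _ _) quadE lt_def sumr_ge0 // andbT; apply: contra x0.
rewrite psumr_eq0 // => /allP h0; rewrite -[x]mul1mx -spectral_mx1 mulmx_suml.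
rewrite big1 // => i _; have := h0 i (mem_index_enum i).
rewrite /= mulf_eq0 gt_eqF //= sqrf_eq0 => /eqP vx.
by rewrite scale1r -mulmxA [X in _ *m X]mx11_scalar vx mul_mx_scalar scale0r.
Qed.

Lemma invmx_spectral_mx (mu : 'I_n -> R) : (forall i, 0 < mu i) ->
  invmx (spectral_mx v mu) = spectral_mx v (fun i => (mu i)^-1).
Proof.
move=> mu0; have u : spectral_mx v mu \in unitmx.
  by apply/posdef_unitmx/posdef_spectral_mx.
apply: eigen_along_eq => k; rewrite -[v k in LHS](scalerK (lt0r_neq0 (mu0 k))).
by rewrite -spectral_mx_eigen -scalemxAr mulKmx.
Qed.

Lemma objective_spectral_mxl (lam : 'I_n -> R) (X : 'M[R]_n) : (forall i, 0 < lam i) ->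
  objective (spectral_mx v lam) X =
  \sum_i (quad X (v i) / lam i + quad (invmx X) (v i) * lam i).
Proof.
by move=> lam0; rewrite /objective invmx_spectral_mx // !trace_mul_spectral_mx -big_split.
Qed.

Lemma objective_spectral_mx (lam mu : 'I_n -> R) :
  (forall i, 0 < lam i) -> (forall i, 0 < mu i) ->
  objective (spectral_mx v lam) (spectral_mx v mu) = \sum_i ratio_cost (mu i) (lam i).
Proof.
move=> lam0 mu0; rewrite objective_spectral_mxl //; apply: eq_bigr => i _.
rewrite invmx_spectral_mx // !(quad_eigen _ (spectral_mx_eigen _)) addrC.
by rewrite /ratio_cost [_ * lam i]mulrC.
Qed.

(** * Feasible matrices and the optimal value *)

(** A projector that kills every u_i reduces Y to b on its range. Its trace n - m is positive, so
    some P v_i is nonzero, and positivity of Y there gives b > 0. *)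
Lemma feasible_projector (m : nat) (Y : 'M[R]_n) : (m < n)%N -> feasible m Y ->
  exists (P : 'M[R]_n) (b : R), [/\ P^T = P, P *m P = P, \sum_i quad P (v i) = (n - m)%:R,
    Y *m P = b *: P & 0 < b].
Proof.
move=> mn [[b [a [u YE]]] [_ Y0]].
pose U : 'M[R]_(m, n) := \matrix_(i, j) u i j 0.
have [|P [Psym PP UP trP _]] := @exists_projector _ m n (n - m) U; first by lia.
have uP i : (u i)^T *m P = 0.
  have <- : row i U = (u i)^T by apply/rowP => j; rewrite !mxE.
  by rewrite -row_mul UP row0.
have sumP : \sum_i quad P (v i) = (n - m)%:R.
  rewrite -trP -[P in RHS]mulmx1 -spectral_mx1 trace_mul_spectral_mx.
  by apply: eq_bigr => i _; rewrite mulr1.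
have YP : Y *m P = b *: P.
  rewrite YE mulmxDl mul_scalar_mx mulmx_suml big1 ?addr0 // => i _.
  by rewrite -scalemxAl -mulmxA uP mulmx0 scaler0.
exists P, b; split=> //.
have [i Pi] : exists i, quad P (v i) != 0.
  apply/existsP; apply: contraT; rewrite negb_exists => /forallP h.
  move: sumP; rewrite big1 => [/eqP|i _]; last by have := h i; rewrite negbK => /eqP.
  by rewrite eq_sym pnatr_eq0 subn_eq0 leqNgt mn.
have := Y0 (P *m v i); rewrite -/(quad _ _) quad_mul Psym -mulmxA YP -scalemxAr PP quadZ.
have /andP[Pge0 _] := quad_projector_bounds Psym PP (v i).
rewrite pmulr_lgt0 ?lt_def ?Pi //; apply; apply: contra_neq Pi => Pv0.
by rewrite quad_projector // Pv0 /quad mulmx0 mxE.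
Qed.

(** Subtracting y times the resolution of the identity leaves only the terms with mu i != y, of
    which there are at most m. *)
Lemma low_rank_shift_spectral_mx (m : nat) (mu : 'I_n -> R) (y : R) :
  (m < n)%N -> (n - m <= #|[pred i | mu i == y]|)%N ->
  low_rank_shift m (spectral_mx v mu).
Proof.
move=> mn hy; pose e := enum [pred i | mu i != y].
have se : (size e <= m)%N.
  have cE : (#|[pred i | mu i == y]| + size e = n)%N.
    rewrite -cardE -[RHS]card_ord -(cardC [pred i | mu i == y]).
    by congr addn; apply: eq_card.
  by rewrite -(leq_add2l #|[pred i | mu i == y]|) cE addnC -leq_subLR.
pose nth_e := nth (Ordinal mn) e.
(* Zero coefficients pad the list to length m; the default index of [nth] is then harmless. *)
exists y, (fun i => if (i < size e)%N then mu (nth_e i) - y else 0),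
  (fun i => v (nth_e i)).
rewrite -scalemx1 -spectral_mx1 /spectral_mx scaler_sumr.
have -> : \sum_(i < m) (if (i < size e)%N then mu (nth_e i) - y else 0) *:
    (v (nth_e i) *m (v (nth_e i))^T) = \sum_(i <- e) (mu i - y) *: (v i *m (v i)^T).
  rewrite (big_nth (Ordinal mn)) big_mkord.
  pose f i := (mu (nth_e i) - y) *: (v (nth_e i) *m (v (nth_e i))^T).
  rewrite (big_ord_widen m f se).
  rewrite [RHS]big_mkcond.
  by apply: eq_bigr => i _; case: ifP => // _; rewrite scale0r.
rewrite big_enum /= [X in _ = _ + X]big_mkcond -big_split; apply: eq_bigr => i _ /=.
rewrite scale1r inE; case: eqP => [->|_]; first by rewrite addr0.
by rewrite -scalerDl addrC subrK.
Qed.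

(** For the multiplicity, put q_i = quad P (v i). Symmetry of the matrix gives (mu i - b) q_i = 0,
    so only indices with mu i = b contribute to the sum n - m of the q_i, each by at most 1. *)
Lemma feasible_spectral_mx (m : nat) (mu : 'I_n -> R) : (m < n)%N ->
  feasible m (spectral_mx v mu) <->
  (forall i, 0 < mu i) /\ exists y, (n - m <= #|[pred i | mu i == y]|)%N.
Proof.
move=> mn; split=> [fX|[mu0 [y hy]]]; last first.
  by split; [apply: low_rank_shift_spectral_mx hy | apply/posdef_spectral_mx].
split; first by case: fX => _ /posdef_spectral_mx.
have [P [b [Psym PP sumP XP _]]] := feasible_projector mn fX; exists b.
rewrite -(ler_nat R) -sumP -sumr_const [leRHS]big_mkcond; apply: ler_sum => i _ /=.
rewrite inE; case: eqP => [_|/eqP mub].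
  by have /andP[_] := quad_projector_bounds Psym PP (v i); rewrite quad_basis.
have : (mu i - b) * quad P (v i) = 0.
  rewrite mulrBl -[b * _]quadZ -XP {2}/quad mulmxA -[X in _ - (X *m _ *m _) _ _]trmxK.
  rewrite trmx_mul trmxK spectral_mx_sym spectral_mx_eigen linearZ /=.
  by rewrite -!scalemxAl mxE subrr.
by move/eqP; rewrite mulf_eq0 subr_eq0 (negPf mub) => /eqP->.
Qed.

Lemma objective_ge (m : nat) (lam : 'I_n -> R) (Y : 'M[R]_n) :
  (m < n)%N -> (forall i, 0 < lam i) ->
  (forall i j : 'I_n, (i <= j)%N -> lam i <= lam j) -> feasible m Y ->
  exists l : 'I_m.+1, m%:R * 2 + window_cost lam l <= objective (spectral_mx v lam) Y.
Proof.
move=> mn lam0 lam_sorted fY.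
have [P [b [Psym PP sumP YP b0]]] := feasible_projector mn fY.
have q01 i : 0 <= quad P (v i) <= 1.
  by have := quad_projector_bounds Psym PP (v i); rewrite quad_basis.
have [l hl] := window_cost_le mn lam0 lam_sorted b0 q01 sumP.
exists l; rewrite (le_trans hl) // objective_spectral_mxl //; apply: ler_sum => i _.
by apply: quad_sum_inv_ge => //; case: fY.
Qed.

Lemma optimal_spectral_mx (m : nat) (lam mu : 'I_n -> R) :
  (m < n)%N -> (forall i, 0 < lam i) ->
  (forall i j : 'I_n, (i <= j)%N -> lam i <= lam j) ->
  optimal m (spectral_mx v lam) (spectral_mx v mu) <-> optimal_eigenvalues m lam mu.
Proof.
move=> mn lam0 lam_sorted; split=> [[fX opt]|[mu0 hy hl]].
  have /feasible_spectral_mx[//|mu0 hy] := fX; split=> // l.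
  (* The competitor built from window l is feasible and its objective is the required bound. *)
  pose nu i := if window l i then window_value lam l else lam i.
  have nu0 i : 0 < nu i by rewrite /nu; case: ifP; rewrite ?window_value_gt0.
  have /opt : feasible m (spectral_mx v nu).
    apply/feasible_spectral_mx => //; split=> //; exists (window_value lam l).
    rewrite -(card_window l (ltnW mn)); apply/subset_leq_card/subsetP => i wi.
    by rewrite inE /nu [window _ _]wi.
  rewrite !objective_spectral_mx //.
  by rewrite (sum_ratio_cost_window (mu := nu) (l := l) (y := window_value lam l)).
split=> [|Y /(objective_ge mn lam0 lam_sorted)[l]].
  exact/feasible_spectral_mx.
by apply: le_trans; rewrite objective_spectral_mx.
Qed.

End OrthonormalBasis.

(** * Characterisation of the optimal solutions, up to relabelling ties *)

Unset Implicit Arguments.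

Theorem theorem7 (R : realType) (m n : nat) (hmn : (m < n)%N)
    (A : 'M[R]_n) (hA : posdef A)
    (lam : 'I_n -> R) (v : 'I_n -> 'cV[R]_n)
    (hlam : forall i j : 'I_n, (i <= j)%N -> lam i <= lam j)
    (hv : orthonormal_basis v) (hAv : eigen_along v A lam) :
  forall (X : 'M[R]_n) (mu : 'I_n -> R), eigen_along v X mu ->
    (optimal m A X <->
       exists s : 'S_n, (forall k : 'I_n, lam (s k) = lam k) /\
         optimal_spectrum m lam (fun k : 'I_n => mu (s k)))
    /\
    ((forall i j : 'I_n, (i <= j)%N -> lam i = lam j -> mu i <= mu j) ->
       (optimal m A X <-> optimal_spectrum m lam mu)).
Proof.
move=> X mu hX.
have lam0 i : 0 < lam i.
  by apply: (posdef_spectral_mx hv lam).1; rewrite -(eigen_along_eq hv hAv).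
rewrite (eigen_along_eq hv hAv) (eigen_along_eq hv hX).
have optE : optimal m (spectral_mx v lam) (spectral_mx v mu) <->
    optimal_eigenvalues m lam mu by exact: optimal_spectral_mx.
split; last first.
  move=> tie; apply: iff_trans optE _; split; last exact: optimal_spectrum_eigenvalues.
  exact: optimal_eigenvalues_spectrum.
apply: iff_trans optE _; split=> [opt|[s [ls spec]]].
  (* Relabelling within ties of [lam] makes [mu] sorted there, as the converse requires, and
     preserves [optimal_eigenvalues]. *)
  have [s ls tie] := exists_perm_sorted_on_ties lam mu; exists s; split=> //.
  by apply: optimal_eigenvalues_spectrum => //; apply/optimal_eigenvalues_perm.
by apply/(optimal_eigenvalues_perm _ _ ls); apply: optimal_spectrum_eigenvalues.
Qed.
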